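(* Let $\Omega,\Lambda,\gamma$ be positive real parameters with $\gamma\ne1$ and $\Lambda\neq\Omega$. The equation $a_1(t)a_4(t)=a_2(t)a_3(t)$ is a quadratic equation in $t\in\mathbb{C}$ whose two roots are $$t_\pm=\frac{(2\Lambda\gamma-\Lambda-\Omega\gamma+i)\Omega\mp i\Omega Q}{2\gamma(\Lambda-\Omega)(i\Lambda\gamma-1)}.$$ Moreover, let $D\subset\mathbb{R}^d$ ($d\in\{2,3\}$) be bounded, and let $T,P$ satisfy the Morse-Ingard equations $$\Omega\nabla^2T+iT-i\frac{\gamma-1}{\gamma}P=S,$$ $$(1-i\gamma\Lambda)\nabla^2P+\left[\gamma\left(1-\frac{\Lambda}{\Omega}\right)+\frac{\Lambda}{\Omega}\right]P-\gamma\left(1-\frac{\Lambda}{\Omega}\right)T=-i\gamma\frac{\Lambda}{\Omega}S$$ in $D^c$, with Neumann boundary conditions $\frac{\partial T}{\partial n}\big|_{\partial D}=g_T$ and $\frac{\partial P}{\partial n}\big|_{\partial D}=g_P$. Then $V_t=\Omega T+t_+(1-i\gamma\Lambda)P$ and $V_p=\Omega T+t_-(1-i\gamma\Lambda)P$ satisfy the decoupled equations $$\nabla^2V_t+k_t^2V_t=a_5(t_+)S,\qquad \nabla^2V_p+k_p^2V_p=a_5(t_-)S$$ in $D^c$, with decoupled Neumann data $$\frac{\partial V_t}{\partial n}\Big|_{\partial D}=\Omega g_T+t_+(1-i\gamma\Lambda)g_P,\qquad \frac{\partial V_p}{\partial n}\Big|_{\partial D}=\Omega g_T+t_-(1-i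\gamma\Lambda)g_P.$$
   Context: $Q$ is a complex constant with $Q^2=4(i\Omega+\gamma\Omega\Lambda)+(1-i\gamma\Omega-i\Lambda)^2$, and $$k_t^2=\frac{i}{2\Omega}\,\frac{1-i\gamma\Omega-i\Lambda+Q}{1-i\gamma\Lambda},\qquad k_p^2=\frac{i}{2\Omega}\,\frac{1-i\gamma\Omega-i\Lambda-Q}{1-i\gamma\Lambda}.$$ The functions $a_j(t)$ are the coefficients of $\nabla^2T,\nabla^2P,T,P,S$ in the sum of the first Morse-Ingard equation and $t$ times the second: $$a_1(t)=\Omega,\quad a_2(t)=(1-i\gamma\Lambda)t,\quad a_3(t)=i-\gamma\left(1-\frac{\Lambda}{\Omega}\right)t,$$ $$a_4(t)=-i\frac{\gamma-1}{\gamma}+\left[\gamma\left(1-\frac{\Lambda}{\Omega}\right)+\frac{\Lambda}{\Omega}\right]t,\quad a_5(t)=1-i\gamma\frac{\Lambda}{\Omega}t.$$ Here $T$ (temperature), $P$ (pressure) and $S$ (heat source) are complex-valued functions on $D^c$, $T$ and $P$ are assumed regular enough for the equations and normal derivatives to make sense, roots are counted with multiplicity, and $n$ is the unit normal on $\partial D$. *)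

(* Defs.v *)
From HB Require Import structures.
From mathcomp Require Import all_boot all_order all_algebra.
From mathcomp Require Import all_classical all_reals all_analysis.
From mathcomp Require Export complex.

Set Implicit Arguments.
Unset Strict Implicit.
Unset Printing Implicit Defensive.
Import Order.TTheory GRing.Theory Num.Theory.
Import numFieldNormedType.Exports.

Local Open Scope classical_set_scope.
Local Open Scope ring_scope.
Local Open Scope complex_scope.

(* Throughout, the real parameters are [Om] (Omega), [La] (Lambda), [ga]
   (gamma), and [x%:C] is the embedding of a real number in [R[i]]. *)

Definition a1 (R : realType) (Om La ga : R) (t : R[i]) : R[i] := Om%:C.

Definition a2 (R : realType) (Om La ga : R) (t : R[i]) : R[i] :=
  (1 - 'i * (ga * La)%:C) * t.

Definition a3 (R : realType) (Om La ga : R) (t : R[i]) : R[i] :=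
  'i - (ga * (1 - La / Om))%:C * t.

Definition a4 (R : realType) (Om La ga : R) (t : R[i]) : R[i] :=
  - 'i * ((ga - 1) / ga)%:C + (ga * (1 - La / Om) + La / Om)%:C * t.

Definition a5 (R : realType) (Om La ga : R) (t : R[i]) : R[i] :=
  1 - 'i * (ga * (La / Om))%:C * t.

Definition Q_squared (R : realType) (Om La ga : R) : R[i] :=
  4 * ('i * Om%:C + (ga * Om * La)%:C)
  + (1 - 'i * (ga * Om)%:C - 'i * La%:C) ^+ 2.

Definition t_plus (R : realType) (Om La ga : R) (Q : R[i]) : R[i] :=
  (((2 * La * ga - La - Om * ga)%:C + 'i) * Om%:C - 'i * Om%:C * Q)
  / (2 * ga%:C * (La - Om)%:C * ('i * (La * ga)%:C - 1)).

Definition t_minus (R : realType) (Om La ga : R) (Q : R[i]) : R[i] :=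
  (((2 * La * ga - La - Om * ga)%:C + 'i) * Om%:C + 'i * Om%:C * Q)
  / (2 * ga%:C * (La - Om)%:C * ('i * (La * ga)%:C - 1)).

Definition kt_squared (R : realType) (Om La ga : R) (Q : R[i]) : R[i] :=
  'i / (2 * Om%:C)
  * ((1 - 'i * (ga * Om)%:C - 'i * La%:C + Q) / (1 - 'i * (ga * La)%:C)).

Definition kp_squared (R : realType) (Om La ga : R) (Q : R[i]) : R[i] :=
  'i / (2 * Om%:C)
  * ((1 - 'i * (ga * Om)%:C - 'i * La%:C - Q) / (1 - 'i * (ga * La)%:C)).

(* The linear combination producing V_t and V_p from (T, P), and their Neumann
   data from (g_T, g_P). *)
Definition combine (R : realType) (Om La ga : R) (t : R[i]) (X : Type)
    (u w : X -> R[i]) : X -> R[i] :=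
  fun x => Om%:C * u x + t * (1 - 'i * (ga * La)%:C) * w x.

(* Since [R[i]] carries no normed module structure over [R], functions with
   values in [R[i]] are differentiated through their real and imaginary
   parts. *)

Definition real_laplacian (R : realType) (d : nat) (f : 'rV[R]_d -> R)
    (x : 'rV[R]_d) : R :=
  \sum_(i < d) 'D_(delta_mx 0 i) ('D_(delta_mx 0 i) f) x.

Definition laplacian (R : realType) (d : nat) (u : 'rV[R]_d -> R[i])
    (x : 'rV[R]_d) : R[i] :=
  real_laplacian (fun y => complex.Re (u y)) x +i* real_laplacian (fun y => complex.Im (u y)) x.

(* ['D_v f] is total, hence the laplacian above is meaningful only for functions
   whose pure second partial derivatives exist. *)
Definition real_has_laplacian (R : realType) (d : nat) (U : set 'rV[R]_d)
    (f : 'rV[R]_d -> R) : Prop :=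
  forall (x : 'rV[R]_d) (i : 'I_d), U x ->
    derivable f x (delta_mx 0 i)
    /\ derivable ('D_(delta_mx 0 i) f) x (delta_mx 0 i).

Definition has_laplacian (R : realType) (d : nat) (U : set 'rV[R]_d)
    (u : 'rV[R]_d -> R[i]) : Prop :=
  real_has_laplacian U (fun y => complex.Re (u y))
  /\ real_has_laplacian U (fun y => complex.Im (u y)).

(* The open exterior of [D]: the complement of [D] when [D] is closed, and the
   complement without the boundary points when [D] is open. *)
Definition exterior (R : realType) (d : nat) (D : set 'rV[R]_d) :
    set 'rV[R]_d :=
  interior (~` D).

Definition boundary (R : realType) (d : nat) (D : set 'rV[R]_d) :
    set 'rV[R]_d :=
  closure D `\` interior D.

Definition dotv (R : realType) (d : nat) (u v : 'rV[R]_d) : R :=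
  \sum_(i < d) u 0 i * v 0 i.

(* The unit vector [v] is normal to the boundary at [x], pointing out of [D]:
   every cone around [v] with apex [x] (and opening less than a half space)
   lies, near [x], outside [D], and the opposite cone lies inside [D].  This
   holds for the usual outward normal of a C^1 domain.  The norm [`|y - x|] is
   the sup norm, which makes no difference since [e] is arbitrary. *)
Definition outward_unit_normal (R : realType) (d : nat) (D : set 'rV[R]_d)
    (x v : 'rV[R]_d) : Prop :=
  dotv v v = 1
  /\ forall e : R, 0 < e ->
       \forall y \near x,
         (e * `|y - x| < dotv v (y - x) -> ~ D y)
         /\ (dotv v (y - x) < - (e * `|y - x|) -> D y).

(* The orientation of the normal is left free. *)
Definition unit_normal_field (R : realType) (d : nat) (D : set 'rV[R]_d)
    (n : 'rV[R]_d -> 'rV[R]_d) : Prop :=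
  forall x : 'rV[R]_d, boundary D x ->
    outward_unit_normal D x (n x) \/ outward_unit_normal D x (- n x).

(* One-sided derivative at [x] in the direction [v], the increment [h] being
   restricted to the side of [x] where [x + h *: v] is in the exterior of [D]. *)
Definition real_exterior_derivative (R : realType) (d : nat)
    (D : set 'rV[R]_d) (f : 'rV[R]_d -> R) (x v : 'rV[R]_d) (l : R) : Prop :=
  (fun h : R => h^-1 * (f (x + h *: v) - f x))
    @ within [set h : R | exterior D (x + h *: v)] (dnbhs (0 : R)) --> l.

Definition exterior_derivative (R : realType) (d : nat) (D : set 'rV[R]_d)
    (u : 'rV[R]_d -> R[i]) (x v : 'rV[R]_d) (l : R[i]) : Prop :=
  real_exterior_derivative D (fun y => complex.Re (u y)) x v (complex.Re l)
  /\ real_exterior_derivative D (fun y => complex.Im (u y)) x v (complex.Im l).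

Definition neumann_data (R : realType) (d : nat) (D : set 'rV[R]_d)
    (n : 'rV[R]_d -> 'rV[R]_d) (u g : 'rV[R]_d -> R[i]) : Prop :=
  forall x : 'rV[R]_d, boundary D x -> exterior_derivative D u x (n x) (g x).

Definition morse_ingard (R : realType) (Om La ga : R) (d : nat)
    (U : set 'rV[R]_d) (T P S : 'rV[R]_d -> R[i]) : Prop :=
  forall x : 'rV[R]_d, U x ->
    Om%:C * laplacian T x + 'i * T x - 'i * ((ga - 1) / ga)%:C * P x = S x
    /\ (1 - 'i * (ga * La)%:C) * laplacian P x
       + (ga * (1 - La / Om) + La / Om)%:C * P x
       - (ga * (1 - La / Om))%:C * T x
       = - 'i * (ga * (La / Om))%:C * S x.

(* Main.v *)
Require Import Defs.
From mathcomp Require Import all_boot all_order all_algebra.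
From mathcomp Require Import all_classical all_reals all_analysis.
From mathcomp Require Import ring.
Import Order.TTheory GRing.Theory Num.Theory.
Import numFieldNormedType.Exports.
Local Open Scope classical_set_scope.
Local Open Scope ring_scope.
Local Open Scope complex_scope.

(* Adding [t] times the second Morse-Ingard equation to the first gives
   [laplacian V + a3 t T + a4 t P = a5 t S] with [V = a1 t T + a2 t P], and the
   zeroth order part is the multiple [(a3 t / Om) V] of [V] exactly when
   [a1 t * a4 t = a2 t * a3 t].  At the two roots of this quadratic the factor
   [a3 t / Om] is [kt_squared], resp. [kp_squared].  Changing the sign of [Q]
   exchanges the two roots and the two wave numbers. *)

(** * Algebra of the quadratic and of the wave numbers *)

(** The sum of the two roots is free of [Q] and their product involves only [Q ^+ 2], so the
    relations for [i ^+ 2] and [Q ^+ 2] reduce the claim to a field identity. With an abstract [i],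
    all letters are atoms for [field]. *)
Lemma quadratic_factorization (F : numFieldType) (i O L g Q t : F) :
  i ^+ 2 = -1 -> O != 0 -> g != 0 -> L - O != 0 -> i * (L * g) - 1 != 0 ->
  Q ^+ 2 = 4 * (i * O + g * O * L) + (1 - i * (g * O) - i * L) ^+ 2 ->
  O * (- i * ((g - 1) / g) + (g * (1 - L / O) + L / O) * t)
    - (1 - i * (g * L)) * t * (i - g * (1 - L / O) * t) =
  (1 - i * (g * L)) * (g * (1 - L / O)) *
    ((t - ((2 * L * g - L - O * g + i) * O - i * O * Q)
            / (2 * g * (L - O) * (i * (L * g) - 1))) *
     (t - ((2 * L * g - L - O * g + i) * O + i * O * Q)
            / (2 * g * (L - O) * (i * (L * g) - 1)))).
Proof.
move=> i2 O0 g0 LO0 d0 Q2; field: i2 Q2.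
by rewrite g0 LO0 O0 d0.
Qed.

(** Both sides are affine in [Q] with equal coefficients. The identity holds for every [Q], so it
    can also be used at [- Q]. *)
Lemma wave_number_identity (F : numFieldType) (i O L g Q : F) :
  i ^+ 2 = -1 -> O != 0 -> g != 0 -> L - O != 0 -> i * (L * g) - 1 != 0 ->
  O * (i / (2 * O) * ((1 - i * (g * O) - i * L + Q) / (1 - i * (g * L)))) =
  i - g * (1 - L / O) *
    (((2 * L * g - L - O * g + i) * O - i * O * Q)
      / (2 * g * (L - O) * (i * (L * g) - 1))).
Proof.
move=> i2 O0 g0 LO0 d0; field: i2.
(* The wave number and the root have opposite denominators, and [field] asks for both to be
   nonzero. *)
have d0' : 1 - i * (g * L) != 0 by rewrite -oppr_eq0 opprB (mulrC g).
by rewrite g0 LO0 O0 d0 d0'.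
Qed.

Lemma real_complex_neq0 (R : realType) (x : R) : x != 0 -> x%:C != 0 :> R[i].
Proof. by rewrite (fmorph_eq0 (real_complex R)). Qed.

(** Squaring ['i * x = 1] would give [1 + x ^+ 2 = 0], which no real [x] satisfies. *)
Lemma one_subiM_neq0 (R : realType) (x : R) : 1 - 'i * x%:C != 0 :> R[i].
Proof.
apply/negP => /eqP/subr0_eq ix1.
have : (1 + x ^+ 2)%:C == 0 :> R[i].
  rewrite rmorphD rmorph1 rmorphXn /= {1}[1 : R[i]](_ : _ = ('i * x%:C) ^+ 2).
    by rewrite exprMn sqrCi mulN1r addNr.
  by rewrite -ix1 expr1n.
rewrite (fmorph_eq0 (real_complex R)); apply/negP; rewrite gt_eqF//.
by rewrite ltr_pwDl// sqr_ge0.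
Qed.

Lemma coefficient_factorization {R : realType} {Om La ga : R} {Q : R[i]}
    (t : R[i]) :
  Om != 0 -> ga != 0 -> La - Om != 0 -> Q ^+ 2 = Q_squared Om La ga ->
  a1 Om La ga t * a4 Om La ga t - a2 Om La ga t * a3 Om La ga t =
  (1 - 'i * (ga * La)%:C) * (ga * (1 - La / Om))%:C *
    ((t - t_plus Om La ga Q) * (t - t_minus Om La ga Q)).
Proof.
move=> /real_complex_neq0 Om0 /real_complex_neq0 ga0 /real_complex_neq0 LO0.
move: (one_subiM_neq0 R (La * ga)); rewrite -oppr_eq0 opprB.
move: LO0; rewrite /a1 /a2 /a3 /a4 /t_plus /t_minus /Q_squared.
(* Pushing the embedding down to the single parameters, in the side conditions too, gives the shape
   of the abstract identity. *)
rewrite !(rmorphM, rmorphD, rmorphN, rmorphB, fmorphV, rmorph1, rmorph_nat) /=.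
by move=> LO0 d0; apply: quadratic_factorization => //; exact: sqrCi.
Qed.

Lemma kt_squared_a3 {R : realType} {Om La ga : R} (Q : R[i]) :
  Om != 0 -> ga != 0 -> La - Om != 0 ->
  Om%:C * kt_squared Om La ga Q = a3 Om La ga (t_plus Om La ga Q).
Proof.
move=> /real_complex_neq0 Om0 /real_complex_neq0 ga0 /real_complex_neq0 LO0.
move: (one_subiM_neq0 R (La * ga)); rewrite -oppr_eq0 opprB.
move: LO0; rewrite /kt_squared /a3 /t_plus.
rewrite !(rmorphM, rmorphD, rmorphN, rmorphB, fmorphV, rmorph1, rmorph_nat) /=.
by move=> LO0 d0; apply: wave_number_identity => //; exact: sqrCi.
Qed.

Lemma t_minusE {R : realType} (Om La ga : R) (Q : R[i]) :
  t_minus Om La ga Q = t_plus Om La ga (- Q).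
Proof. by rewrite /t_plus mulrN opprK. Qed.

Lemma kp_squaredE {R : realType} (Om La ga : R) (Q : R[i]) :
  kp_squared Om La ga Q = kt_squared Om La ga (- Q).
Proof. by []. Qed.

(** * Linearity of the Laplacian, first over the reals, then over the complex numbers *)

Lemma derivable_comb {R : realType} {V : normedModType R} {f g : V -> R}
    (a b : R) {x v : V} :
  derivable f x v -> derivable g x v ->
  derivable (a \*: f + b \*: g : V -> R) x v.
Proof.
by move=> fx gx; apply: derivableD; apply: derivableZ.
Qed.

Lemma derive_comb {R : realType} {V : normedModType R} {f g : V -> R}
    (a b : R) {x v : V} :
  derivable f x v -> derivable g x v ->
  'D_v (a \*: f + b \*: g : V -> R) x = a * 'D_v f x + b * 'D_v g x.
Proof.
move=> fx gx; rewrite deriveD; try exact: derivableZ.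
by rewrite !deriveZ.
Qed.

(* The first order partial derivatives of [a f + b g] are only known on [U],
   so [U] must be open for them to be differentiated again. *)
Lemma real_has_laplacian_comb {R : realType} {d : nat} {U : set 'rV[R]_d}
    (f g : 'rV[R]_d -> R) (a b : R) :
  open U -> real_has_laplacian U f -> real_has_laplacian U g ->
  real_has_laplacian U (fun y => a * f y + b * g y) /\
  {in U, forall x, real_laplacian (fun y => a * f y + b * g y) x =
                   a * real_laplacian f x + b * real_laplacian g x}.
Proof.
move=> Uo Hf Hg.
have combE (p q : 'rV[R]_d -> R) :
  (fun y => a * p y + b * q y) = (a \*: p + b \*: q) by [].
have near_D (x : 'rV[R]_d) (i : 'I_d) : U x ->
    \near x, (a \*: 'D_(delta_mx 0 i) f + b \*: 'D_(delta_mx 0 i) g) x =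
             'D_(delta_mx 0 i) (a \*: f + b \*: g : 'rV[R]_d -> R) x.
  move=> Ux; near=> y.
  have Uy : U y by near: y; exact: open_nbhs_nbhs.
  by rewrite (derive_comb a b (Hf y i Uy).1 (Hg y i Uy).1).
rewrite combE; split=> [x i Ux|x /set_mem Ux].
  split; first exact: (derivable_comb a b (Hf x i Ux).1 (Hg x i Ux).1).
  (* Derivability at [x] depends only on values near [x], so the combination of the partial
     derivatives may replace the partial derivative of the combination. *)
  apply: near_eq_derivable (near_D x i Ux) _.
  exact: (derivable_comb a b (Hf x i Ux).2 (Hg x i Ux).2).
rewrite /real_laplacian !mulr_sumr -big_split/=; apply: eq_bigr => i _.
rewrite -(derive_comb a b (Hf x i Ux).2 (Hg x i Ux).2).
by apply/esym/near_eq_derive/near_D.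
Unshelve. all: by end_near. Qed.

Lemma complex_mulE {R : realType} (c : R[i]) (x y : R) :
  c * (x +i* y) = (complex.Re c * x + - complex.Im c * y)
                  +i* (complex.Im c * x + complex.Re c * y).
Proof. by case: c => a b; rewrite mulNr [b * x + _]addrC. Qed.

(* The factors [1], and the sign [- complex.Im c] above, give both parts the
   shape [a * f + b * g] of the real lemmas. *)
Lemma complex_addE {R : realType} (x y x' y' : R) :
  (x +i* y) + (x' +i* y') = (1 * x + 1 * x') +i* (1 * y + 1 * y') :> R[i].
Proof. by rewrite !mul1r. Qed.

Lemma Re_mul {R : realType} (c z : R[i]) :
  complex.Re (c * z) = complex.Re c * complex.Re z + - complex.Im c * complex.Im z.
Proof. by case: z => x y; rewrite complex_mulE. Qed.

Lemma Im_mul {R : realType} (c z : R[i]) :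
  complex.Im (c * z) = complex.Im c * complex.Re z + complex.Re c * complex.Im z.
Proof. by case: z => x y; rewrite complex_mulE. Qed.

Lemma Re_add {R : realType} (z w : R[i]) :
  complex.Re (z + w) = 1 * complex.Re z + 1 * complex.Re w.
Proof. by case: z w => x y [x' y']; rewrite complex_addE. Qed.

Lemma Im_add {R : realType} (z w : R[i]) :
  complex.Im (z + w) = 1 * complex.Im z + 1 * complex.Im w.
Proof. by case: z w => x y [x' y']; rewrite complex_addE. Qed.

(** Multiplication by [c] mixes the two parts of [u]: the real lemma is applied twice to this pair,
    with the rows of the real 2 by 2 matrix of [c] as coefficients. *)
Lemma has_laplacianZ {R : realType} {d : nat} {U : set 'rV[R]_d}
    (u : 'rV[R]_d -> R[i]) (c : R[i]) :
  open U -> has_laplacian U u ->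
  has_laplacian U (fun y => c * u y) /\
  {in U, forall x, laplacian (fun y => c * u y) x = c * laplacian u x}.
Proof.
move=> Uo [uRe uIm]; rewrite /has_laplacian /laplacian.
rewrite (funext (fun y => Re_mul c (u y))) (funext (fun y => Im_mul c (u y))).
have [HRe LRe] := real_has_laplacian_comb _ _ (complex.Re c) (- complex.Im c) Uo uRe uIm.
have [HIm LIm] := real_has_laplacian_comb _ _ (complex.Im c) (complex.Re c) Uo uRe uIm.
split=> [|x Ux]; first exact: (conj HRe HIm).
rewrite (LRe x Ux) (LIm x Ux).
by rewrite complex_mulE.
Qed.

Lemma has_laplacianD {R : realType} {d : nat} {U : set 'rV[R]_d}
    (u w : 'rV[R]_d -> R[i]) :
  open U -> has_laplacian U u -> has_laplacian U w ->
  has_laplacian U (fun y => u y + w y) /\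
  {in U, forall x, laplacian (fun y => u y + w y) x =
                   laplacian u x + laplacian w x}.
Proof.
move=> Uo [uRe uIm] [wRe wIm]; rewrite /has_laplacian /laplacian.
rewrite (funext (fun y => Re_add (u y) (w y))) (funext (fun y => Im_add (u y) (w y))).
have [HRe LRe] := real_has_laplacian_comb _ _ 1 1 Uo uRe wRe.
have [HIm LIm] := real_has_laplacian_comb _ _ 1 1 Uo uIm wIm.
split=> [|x Ux]; first exact: (conj HRe HIm).
rewrite (LRe x Ux) (LIm x Ux).
by rewrite complex_addE.
Qed.

Lemma has_laplacian_combine {R : realType} {d : nat} {U : set 'rV[R]_d}
    (Om La ga : R) (t : R[i]) (u w : 'rV[R]_d -> R[i]) :
  open U -> has_laplacian U u -> has_laplacian U w ->
  has_laplacian U (combine Om La ga t u w) /\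
  {in U, forall x, laplacian (combine Om La ga t u w) x =
     combine Om La ga t (laplacian u) (laplacian w) x}.
Proof.
move=> Uo Hu Hw.
have [cu Lu] := has_laplacianZ u Om%:C Uo Hu.
have [cw Lw] := has_laplacianZ w (t * (1 - 'i * (ga * La)%:C)) Uo Hw.
have [H L] := has_laplacianD _ _ Uo cu cw.
split=> [//|x Ux]; rewrite (L x Ux) (Lu x Ux) (Lw x Ux) /combine.
by [].
Qed.

(** * Linearity of the one-sided normal derivative and of the Neumann data *)

Lemma real_exterior_derivative_comb {R : realType} {d : nat}
    {D : set 'rV[R]_d} (f g : 'rV[R]_d -> R) (x v : 'rV[R]_d) (a b l m : R) :
  real_exterior_derivative D f x v l -> real_exterior_derivative D g x v m ->
  real_exterior_derivative D (fun y => a * f y + b * g y) x v (a * l + b * m).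
Proof.
rewrite /real_exterior_derivative => Hf Hg.
(* The difference quotient is linear in the function for every [h], 0 included, and all limits are
   along the same filter. *)
rewrite (_ : (fun h : R => _) = fun h => a * (h^-1 * (f (x + h *: v) - f x))
  + b * (h^-1 * (g (x + h *: v) - g x))); last by apply/funext => h; ring.
by apply: cvgD; apply: cvgMr.
Qed.

Lemma exterior_derivativeZ {R : realType} {d : nat} {D : set 'rV[R]_d}
    (c : R[i]) {u : 'rV[R]_d -> R[i]} {x v : 'rV[R]_d} {l : R[i]} :
  exterior_derivative D u x v l ->
  exterior_derivative D (fun y => c * u y) x v (c * l).
Proof.
move=> [uRe uIm]; rewrite /exterior_derivative Re_mul Im_mul.
rewrite (funext (fun y => Re_mul c (u y))) (funext (fun y => Im_mul c (u y))).
split; exact: real_exterior_derivative_comb.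
Qed.

Lemma exterior_derivativeD {R : realType} {d : nat} {D : set 'rV[R]_d}
    {u w : 'rV[R]_d -> R[i]} {x v : 'rV[R]_d} {l m : R[i]} :
  exterior_derivative D u x v l -> exterior_derivative D w x v m ->
  exterior_derivative D (fun y => u y + w y) x v (l + m).
Proof.
move=> [uRe uIm] [wRe wIm]; rewrite /exterior_derivative Re_add Im_add.
rewrite (funext (fun y => Re_add (u y) (w y))) (funext (fun y => Im_add (u y) (w y))).
split; exact: real_exterior_derivative_comb.
Qed.

Lemma neumann_data_combine {R : realType} {d : nat} {D : set 'rV[R]_d}
    {n : 'rV[R]_d -> 'rV[R]_d} {Om La ga : R} (t : R[i])
    {u w gu gw : 'rV[R]_d -> R[i]} :
  neumann_data D n u gu -> neumann_data D n w gw ->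
  neumann_data D n (combine Om La ga t u w) (combine Om La ga t gu gw).
Proof.
move=> Hu Hw x Dx; apply: exterior_derivativeD.
- exact: exterior_derivativeZ (Hu x Dx).
- exact: exterior_derivativeZ (Hw x Dx).
Qed.

(** * Decoupling of the equations *)

(** Keeping [t] an arbitrary root, and [k] any number tied to it by [a3], lets one argument serve
    both [V_t] and [V_p]. *)
Lemma decoupled_equation {R : realType} {d : nat} {U : set 'rV[R]_d}
    {Om La ga : R} {t k : R[i]} {T P S : 'rV[R]_d -> R[i]} :
  Om != 0 -> open U -> has_laplacian U T -> has_laplacian U P ->
  morse_ingard Om La ga U T P S ->
  a1 Om La ga t * a4 Om La ga t - a2 Om La ga t * a3 Om La ga t = 0 ->
  Om%:C * k = a3 Om La ga t ->
  forall x : 'rV[R]_d, U x ->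
    laplacian (combine Om La ga t T P) x + k * combine Om La ga t T P x
    = a5 Om La ga t * S x.
Proof.
move=> /real_complex_neq0 Om0 Uo HT HP MI /subr0_eq root_t k_a3 x Ux.
have [_ ->] := has_laplacian_combine Om La ga t T P Uo HT HP; last exact: mem_set.
have [eqT eqP] := MI x Ux.
have a2E : t * (1 - 'i * (ga * La)%:C) = a2 Om La ga t by rewrite mulrC.
(* The right-hand sides of the two equations, weighted by 1 and [t]. *)
have a5E : a5 Om La ga t * S x = S x + t * (- 'i * (ga * (La / Om))%:C * S x).
  by rewrite /a5; ring.
(* The root condition makes the pairs [(a3, a4)] and [(a1, a2)] proportional at [t]. *)
have zeroth : a3 Om La ga t * (Om%:C * T x + a2 Om La ga t * P x) =
    Om%:C * (a3 Om La ga t * T x + a4 Om La ga t * P x).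
  transitivity (Om%:C * a3 Om La ga t * T x +
                a2 Om La ga t * a3 Om La ga t * P x); first by ring.
  by rewrite -root_t -[a1 _ _ _ _]/(Om%:C); ring.
(* [k] is known only through [Om%:C * k], so the equation is first multiplied by [Om%:C]. *)
apply: (mulfI Om0); rewrite a5E -eqP -{1}eqT /combine mulrDr mulrA k_a3 a2E zeroth.
by rewrite /a2 /a3 /a4; move: (laplacian T x) (laplacian P x) => lT lP; ring.
Qed.

Theorem mainTheorem2 (R : realType) (Om La ga : R) (Q : R[i])
    (Om_gt0 : 0 < Om) (La_gt0 : 0 < La) (ga_gt0 : 0 < ga)
    (ga_neq1 : ga <> 1) (La_neqOm : La <> Om)
    (Q2 : Q ^+ 2 = Q_squared Om La ga) :
  (exists q : {poly R[i]},
     [/\ (forall t : R[i],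
            q.[t] = a1 Om La ga t * a4 Om La ga t
                    - a2 Om La ga t * a3 Om La ga t),
         size q = 3%N
       & q = lead_coef q *: (('X - (t_plus Om La ga Q)%:P)
                             * ('X - (t_minus Om La ga Q)%:P))])
  /\
  (forall (d : nat) (D : set 'rV[R]_d) (n : 'rV[R]_d -> 'rV[R]_d)
          (T P S gT gP : 'rV[R]_d -> R[i]),
     d = 2%N \/ d = 3%N ->
     bounded_set D ->
     unit_normal_field D n ->
     has_laplacian (exterior D) T ->
     has_laplacian (exterior D) P ->
     morse_ingard Om La ga (exterior D) T P S ->
     neumann_data D n T gT ->
     neumann_data D n P gP ->
     let tp := t_plus Om La ga Q in
     let tm := t_minus Om La ga Q in
     let Vt := combine Om La ga tp T P in
     let Vp := combine Om La ga tm T P in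
     [/\ has_laplacian (exterior D) Vt /\ has_laplacian (exterior D) Vp,
         forall x : 'rV[R]_d, exterior D x ->
           laplacian Vt x + kt_squared Om La ga Q * Vt x
           = a5 Om La ga tp * S x,
         forall x : 'rV[R]_d, exterior D x ->
           laplacian Vp x + kp_squared Om La ga Q * Vp x
           = a5 Om La ga tm * S x,
         neumann_data D n Vt (combine Om La ga tp gT gP)
       & neumann_data D n Vp (combine Om La ga tm gT gP)]).
Proof.
have Om0 : Om != 0 by rewrite gt_eqF.
have ga0 : ga != 0 by rewrite gt_eqF.
have LO0 : La - Om != 0 by rewrite subr_eq0; exact/eqP.
have fact t := coefficient_factorization t Om0 ga0 LO0 Q2.
split.
  (* The coefficient of [t ^+ 2] in [a1 a4 - a2 a3]. The witness is [c] times a monic product of two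
     linear factors, so a double root is counted twice. *)
  set c := (1 - 'i * (ga * La)%:C) * (ga * (1 - La / Om))%:C.
  set p := ('X - _) * _.
  have c0 : c != 0.
    rewrite mulf_neq0 ?one_subiM_neq0// real_complex_neq0// mulf_neq0//.
    (* [1 - La / Om] is [(Om - La) / Om], nonzero because [La] differs from [Om]; this makes the
       degree exactly two. *)
    by rewrite -(divff Om0) -mulrBl mulf_neq0 ?invr_eq0// -oppr_eq0 opprB.
  have p_monic : p \is monic by rewrite monicMl ?monicXsubC.
  exists (c *: p); split.
  - by move=> t; rewrite fact !hornerE.
  - by rewrite size_scale// size_Mmonic ?monicXsubC ?polyXsubC_eq0// !size_XsubC.
  - by rewrite lead_coefZ (monicP p_monic) mulr1.
move=> d D n T P S gT gP _ _ _ HT HP MI NT NP tp tm Vt Vp.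
have Uo : open (exterior D) by exact: open_interior.
have tp_root : a1 Om La ga tp * a4 Om La ga tp - a2 Om La ga tp * a3 Om La ga tp = 0.
  by rewrite fact subrr mul0r mulr0.
have tm_root : a1 Om La ga tm * a4 Om La ga tm - a2 Om La ga tm * a3 Om La ga tm = 0.
  by rewrite fact subrr !mulr0.
split.
- by split; [exact: (has_laplacian_combine _ _ _ _ _ _ Uo HT HP).1
            |exact: (has_laplacian_combine _ _ _ _ _ _ Uo HT HP).1].
- by apply: decoupled_equation => //; exact: kt_squared_a3.
- apply: decoupled_equation => //.
  by rewrite kp_squaredE /tm t_minusE; exact: kt_squared_a3.
- exact: neumann_data_combine.
- exact: neumann_data_combine.
Qed.
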